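(* Let $q$ be a power of a prime $p$. Let $\ell_1,\dots,\ell_s$ ($s\ge1$) be nonnegative integers such that the sum $k=\ell_1+\cdots+\ell_s$ is carry-free in base $p$. Suppose that $S_j\in\mathcal B_{W_{\ell_j}^{\mathrm{Luc}}}$ for $1\le j\le s$, and that the subsets $S_1,\dots,S_s$ of $\mathbb P^1(\mathbb F_q)$ are pairwise disjoint. Then $S:=S_1\cup\cdots\cup S_s$ belongs to $\mathcal B_{W_k^{\mathrm{Luc}}}$. In particular, $\mathcal B_{W_k^{\mathrm{Luc}}}\neq\varnothing$.
   Context: For nonnegative integers $i,k$ with base-$p$ expansions $i=\sum_r i_rp^r$, $k=\sum_r k_rp^r$ ($0\le i_r,k_r\le p-1$), write $i\le_p k$ if $i_r\le k_r$ for all $r$. The sum $\ell_1+\cdots+\ell_s$ is carry-free in base $p$ if, for every $r$, the sum of the $r$-th base-$p$ digits of $\ell_1,\dots,\ell_s$ is less than $p$. $\mathbb F_q[X,Y]_k$ is the space of homogeneous polynomials of degree $k$ over $\mathbb F_q$. The Lucas subspace is $W_k^{\mathrm{Luc}}=\mathrm{span}_{\mathbb F_q}\{X^{k-i}Y^i:0\le i\le k,\ i\le_p k\}\subseteq\mathbb F_q[X,Y]_k$. $\mathbb P^1(\mathbb F_q)=\mathbb F_q\cup\{\infty\}$. For a $k$-subset $S\subseteq\mathbb P^1(\mathbb F_q)$, $F_S(X,Y)=\prod_{t\in S}(X-tY)$, where the factor for $t=\infty$ is taken to be $Y$. For a subspace $W\subseteq\mathbb F_q[X,Y]_k$, $\mathcal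 B_W=\{S\subseteq\mathbb P^1(\mathbb F_q): |S|=k,\ F_S\in W\}$. *)

(* Defs.v *)
From HB Require Import structures.
From mathcomp Require Import all_boot all_order all_algebra.
From mathcomp Require Export mpoly.

Set Implicit Arguments.
Unset Strict Implicit.
Unset Printing Implicit Defensive.

Import GRing.Theory.
Local Open Scope ring_scope.

Definition digit (p n r : nat) : nat := ((n %/ p ^ r) %% p)%N.

Lemma digit_small (p n r : nat) : (1 < p)%N -> (n <= r)%N -> digit p n r = 0%N.
Proof.
move=> p_gt1 le_nr; rewrite /digit divn_small ?mod0n //.
exact: leq_ltn_trans le_nr (ltn_expl _ p_gt1).
Qed.

(* Only positions below [maxn i k] are tested, to get a boolean; the other     *)
(* digits vanish, so this is the unbounded condition: see [digit_leP].         *)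
Definition digit_le (p i k : nat) : bool :=
  [forall r : 'I_(maxn i k), (digit p i r <= digit p k r)%N].

Lemma digit_leP (p i k : nat) : (1 < p)%N ->
  reflect (forall r : nat, (digit p i r <= digit p k r)%N) (digit_le p i k).
Proof.
move=> p_gt1; apply: (iffP forallP) => [le_ik r | le_ik r]; last exact: le_ik.
have [lt_r | ] := ltnP r (maxn i k); first exact: (le_ik (Ordinal lt_r)).
by rewrite geq_max => /andP[le_ir _]; rewrite digit_small.
Qed.

Definition carry_free (p s : nat) (l : 'I_s -> nat) : Prop :=
  forall r : nat, (\sum_(j < s) digit p (l j) r < p)%N.

Section BinaryForms.

Variable F : finFieldType.

Definition varX : {mpoly F[2]} := 'X_(ord0 : 'I_2).
Definition varY : {mpoly F[2]} := 'X_(ord_max : 'I_2).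

Lemma varX_homog : varX \is 1.-homog.
Proof. by rewrite dhomogX /= mdeg1. Qed.

Lemma varY_homog : varY \is 1.-homog.
Proof. by rewrite dhomogX /= mdeg1. Qed.

Lemma monXY_homog (k : nat) (i : 'I_k.+1) :
  varX ^+ (k - i) * varY ^+ i \is k.-homog.
Proof.
have hX := dhomogMn (k - i) varX_homog; have hY := dhomogMn i varY_homog.
have := dhomogM hX hY; by rewrite !mul1n subnK // leq_ord.
Qed.

Definition monXY (k : nat) (i : 'I_k.+1) : dhomog 2 F k :=
  DHomog (monXY_homog i).

Definition lucas_space (p k : nat) : {vspace dhomog 2 F k} :=
  <<[seq monXY i | i : 'I_k.+1 <- enum 'I_k.+1 & digit_le p i k]>>%VS.

(* The projective line is [option F], with [None] as the point at infinity.    *)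
Definition linear_factor (t : option F) : {mpoly F[2]} :=
  if t is Some a then varX - a *: varY else varY.

Definition root_form (S : {set option F}) : {mpoly F[2]} :=
  \prod_(t in S) linear_factor t.

Lemma linear_factor_homog (t : option F) : linear_factor t \is 1.-homog.
Proof.
case: t => [a|] /=; last exact: varY_homog.
by rewrite rpredB ?varX_homog // rpredZ ?varY_homog.
Qed.

Lemma root_form_homog (S : {set option F}) : root_form S \is #|S|.-homog.
Proof.
rewrite /root_form -sum1_card.
elim/big_ind2: _ => [|d P e Q|t _]; first exact: dhomog1.
  exact: dhomogM.
exact: linear_factor_homog.
Qed.

(* ['dhomog_k P] is [P] itself, seen in the space of forms of degree [k], when *)
(* [P] is homogeneous of degree [k], as it is here; its default value on other *)
(* polynomials plays no role: see [blocksP].                                   *)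
Definition blocks (k : nat) (W : {vspace dhomog 2 F k}) : {set {set option F}} :=
  [set S : {set option F} |
    (#|S| == k) && (['dhomog_k (root_form S)] \in W)].

Lemma blocksP (k : nat) (W : {vspace dhomog 2 F k}) (S : {set option F}) :
  reflect (#|S| = k /\ exists2 w : dhomog 2 F k, w \in W & val w = root_form S)
          (S \in blocks W).
Proof.
rewrite inE; apply: (iffP andP) => [[/eqP cS WS] | [cS [w Ww def_w]]].
  split=> //; exists ['dhomog_k (root_form S)] => //.
  by rewrite insubdK // -topredE /= -cS; apply: root_form_homog.
rewrite cS eqxx; split=> //; suff -> : ['dhomog_k (root_form S)] = w by [].
by rewrite -def_w; apply: valKd.
Qed.

End BinaryForms.

(* Main.v *)
(* Digitwise, a carry-free sum of integers is computed without carries, so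
   [i1 <=_p l1] and [i2 <=_p l2] give [i1 + i2 <=_p l1 + l2] when [l1 + l2] is
   carry-free.  Hence a product of forms in Lucas spaces of degrees [l_j] lies
   in the Lucas space of degree [k], and the form attached to a disjoint union
   is the product of the forms attached to its parts. *)
Require Import Defs.
From mathcomp Require Import all_boot all_order all_algebra.

Import GRing.Theory.

Lemma digit0n (p r : nat) : digit p 0 r = 0%N.
Proof. by rewrite /digit div0n mod0n. Qed.

Lemma digit0 (p n : nat) : digit p n 0 = (n %% p)%N.
Proof. by rewrite /digit expn0 divn1. Qed.

Lemma digitS (p n r : nat) : digit p n r.+1 = digit p (n %/ p) r.
Proof. by rewrite /digit expnS divnMA. Qed.

(** Induction on the position, dividing by [p] at each step: as the lowest digits produce no carry,
    the quotient of [a + b] by [p] is the sum of the quotients, and these are again carry-free. *)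
Lemma digitD (p a b : nat) :
  (forall r, digit p a r + digit p b r < p)%N ->
  forall r, digit p (a + b) r = (digit p a r + digit p b r)%N.
Proof.
move=> nocarry r; elim: r a b nocarry => [|r IHr] a b nocarry.
  rewrite !digit0 -modnDm modn_small //.
  by have := nocarry 0%N; rewrite !digit0.
have lt0 := nocarry 0%N; rewrite !digit0 in lt0.
have p_gt0 : (0 < p)%N by apply: leq_ltn_trans lt0.
rewrite !digitS divnD // leqNgt lt0 addn0; apply: IHr => r'.
by have := nocarry r'.+1; rewrite !digitS.
Qed.

Lemma carry_free_widen (p s : nat) (l : 'I_s.+1 -> nat) :
  carry_free p l -> carry_free p (fun j : 'I_s => l (widen_ord (leqnSn s) j)).
Proof.
move=> cf r; apply: leq_ltn_trans (cf r).
by rewrite big_ord_recr leq_addr.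
Qed.

Lemma digit_sum (p s : nat) (l : 'I_s -> nat) : carry_free p l ->
  forall r, digit p (\sum_(j < s) l j) r = (\sum_(j < s) digit p (l j) r)%N.
Proof.
elim: s l => [|s IHs] l cf r; first by rewrite !big_ord0 digit0n.
have IH := IHs _ (carry_free_widen _ _ _ cf).
rewrite !big_ord_recr /= digitD ?IH // => r'.
by rewrite IH; have := cf r'; rewrite big_ord_recr.
Qed.

(** The digits of [i] and [j] are dominated by those of [a] and [b], so [i + j] is carry-free too
    and both sides can be compared digit by digit. *)
Lemma digit_leD (p a b i j : nat) : (1 < p)%N ->
  (forall r, digit p a r + digit p b r < p)%N ->
  digit_le p i a -> digit_le p j b -> digit_le p (i + j) (a + b).
Proof.
move=> p_gt1 nocarry /(digit_leP _ _ p_gt1) le_ia /(digit_leP _ _ p_gt1) le_jb.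
apply/digit_leP => // r; rewrite !digitD ?leq_add // => r'.
by apply: leq_ltn_trans (nocarry r'); rewrite leq_add.
Qed.

(** Stated on bare polynomials, with no degree in the type, so that products of forms of different
    degrees need no casts. Only the exponent of [varY] is tested. *)
Definition lucas_supported {F : finFieldType} (p k : nat) (P : {mpoly F[2]}) :=
  all (fun m : 'X_{1..2} => digit_le p (m ord_max) k) (msupp P).

(** Each monomial of [P * Q] is a monomial of [P] times one of [Q], so the exponents of [varY] add
    up. *)
Lemma lucas_supportedM (F : finFieldType) (p a b : nat) (P Q : {mpoly F[2]}) :
  (1 < p)%N -> (forall r, digit p a r + digit p b r < p)%N ->
  lucas_supported p a P -> lucas_supported p b Q ->
  lucas_supported p (a + b) (P * Q)%R.
Proof.
move=> p_gt1 nocarry /allP supP /allP supQ; apply/allP => m.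
move/msuppM_le/allpairsP => [[m1 m2] /= [/supP le1 /supQ le2 ->]].
by rewrite mnmDE digit_leD.
Qed.

Lemma lucas_supported_prod (F : finFieldType) (p s : nat) (l : 'I_s -> nat)
    (P : 'I_s -> {mpoly F[2]}) :
  (1 < p)%N -> carry_free p l ->
  (forall j, lucas_supported p (l j) (P j)) ->
  lucas_supported p (\sum_(j < s) l j) (\prod_(j < s) P j)%R.
Proof.
move=> p_gt1; elim: s l P => [|s IHs] l P cf supP.
  rewrite !big_ord0 /lucas_supported msupp1 /= andbT mnm0E.
  exact/digit_leP.
rewrite !big_ord_recr; apply: lucas_supportedM => //; last first.
  exact: IHs (carry_free_widen _ _ _ cf) _.
(* The digits of the partial sum are sums of digits, so the carry-free condition on all of [l] is
   what the last product requires. *)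
move=> r; rewrite digit_sum; last exact: carry_free_widen.
by have := cf r; rewrite big_ord_recr.
Qed.

Lemma monXYE (F : finFieldType) (k : nat) (i : 'I_k.+1) :
  val (monXY F i) = 'X_[U_(ord0) *+ (k - i) + U_(ord_max) *+ i].
Proof. by rewrite mpolyXD -!mpolyXn. Qed.

(** In degree [k] a monomial is determined by its exponent of [varY], so the monomial expansion of
    [w] is an expansion in the [monXY]. *)
Lemma lucas_spaceE (F : finFieldType) (p k : nat) (w : dhomog 2 F k) :
  (w \in lucas_space F p k) = lucas_supported p k (val w).
Proof.
apply/idP/allP => [|supw].
  rewrite /lucas_space; set X := map _ _.
  move/(@coord_span _ _ _ (in_tuple X)) => def_w m.
  (* By contraposition: every generator has coefficient zero at a monomial whose exponent of [varY]
     fails [digit_le]. *)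
  rewrite mcoeff_msupp; apply: contraNT => Nle_m.
  rewrite def_w raddf_sum raddf_sum /= big1 // => i _.
  rewrite linearZ /=.
  have /mapP[j] : (X`_i)%R \in X by rewrite mem_nth.
  rewrite mem_filter => /andP[le_j _] ->.
  rewrite -[mpoly_of_dhomog _]/(val (monXY F j)) monXYE mcoeffX.
  case: eqP => [def_m|_]; last by rewrite mulr0.
  by move: Nle_m; rewrite -def_m mnmDE !mulmnE !mnm1E /= add0n mul1n le_j.
have homw : forall m, m \in msupp (val w) -> (m ord0 + m ord_max)%N = k.
  move=> m /(dhomog_mf (valP w)) <-.
  rewrite -[RHS]/(mdeg m) mdegE big_ord_recr big_ord1.
  by congr (m _ + _)%N; apply: val_inj.
(* Homogeneity bounds the exponent of [varY] by [k], so [inord] does not fall back on its default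
   value. *)
have XYE m : m \in msupp (val w) ->
    'X_[m] = val (monXY F (inord (m ord_max) : 'I_k.+1)).
  move=> /homw def_k; have lt_m : (m ord_max < k.+1)%N.
    by rewrite ltnS -def_k leq_addl.
  rewrite monXYE inordK // -{1}def_k addnK; congr 'X_[_]; apply/mnmP => i.
  rewrite mnmDE !mulmnE !mnm1E.
  case: i => [[|[|//]] lt_i] /=; rewrite ?mul0n ?mul1n ?addn0;
    by congr (m _); apply: val_inj.
suff -> : w = (\sum_(m <- msupp (val w))
    (val w)@_m *: monXY F (inord (m ord_max) : 'I_k.+1))%R.
  rewrite big_seq; apply: rpred_sum => m m_w; apply/rpredZ/memv_span/map_f.
  rewrite mem_filter mem_enum andbT inordK ?supw //.
  by rewrite ltnS -(homw m m_w) leq_addl.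
apply: val_inj; rewrite [LHS]mpolyE raddf_sum /= big_seq [RHS]big_seq.
by apply: eq_bigr => m m_w; rewrite XYE.
Qed.

Lemma blocks_lucasE (F : finFieldType) (p k : nat) (S : {set option F}) :
  (S \in blocks (lucas_space F p k)) =
  (#|S| == k) && lucas_supported p k (root_form S).
Proof.
apply/blocksP/andP => [[cS [w]] | [/eqP cS supS]].
  by rewrite lucas_spaceE => supw <-; rewrite cS.
split=> //; have := root_form_homog S; rewrite cS => homS.
by exists (DHomog homS); rewrite ?lucas_spaceE.
Qed.

Theorem corollary3 (p e q : nat) (hp : prime p) (he : (0 < e)%N)
    (hq : q = (p ^ e)%N) (F : finFieldType) (hF : #|F| = q)
    (s : nat) (hs : (1 <= s)%N) (l : 'I_s -> nat) (k : nat)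
    (hk : k = (\sum_(j < s) l j)%N) (hcf : carry_free p l)
    (S : 'I_s -> {set option F})
    (hS : forall j : 'I_s, S j \in blocks (lucas_space F p (l j)))
    (hdisj : forall i j : 'I_s, i != j -> [disjoint S i & S j]) :
  (\bigcup_(j < s) S j)%SET \in blocks (lucas_space F p k) /\
  blocks (lucas_space F p k) != set0.
Proof.
have block_S j : #|S j| = l j /\ lucas_supported p (l j) (root_form (S j)).
  by have := hS j; rewrite blocks_lucasE => /andP[/eqP].
suff inB : (\bigcup_(j < s) S j)%SET \in blocks (lucas_space F p k).
  by split=> //; apply/set0Pn; exists (\bigcup_(j < s) S j)%SET.
rewrite blocks_lucasE hk; apply/andP; split.
  (* Disjointness splits a big operation over the union into one over the parts: here for the
     cardinality, then for the product defining [root_form]. *)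
  rewrite -sum1_card partition_disjoint_bigcup //; apply/eqP/eq_bigr => j _.
  by rewrite sum1_card; case: (block_S j).
rewrite /root_form partition_disjoint_bigcup //.
apply: lucas_supported_prod => // [|j]; first exact: prime_gt1.
by case: (block_S j).
Qed.
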